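(* If $S=tI_n$ with $t\ge n/2$, then the function $\Sigma\mapsto I(S\|\Sigma)$ is convex over the set of all $n\times n$ correlation matrices. In particular, for every linear correlation model $M$, its convexity cone $C(M)$ is non-empty.
   Context: $\mathbb{S}^n$ is the space of real symmetric $n\times n$ matrices and $\mathbb{S}^n_+$ its subset of positive definite matrices. For $\Sigma_1,\Sigma_2\in\mathbb{S}^n_+$, $I(\Sigma_1\|\Sigma_2)=\mathrm{trace}(\Sigma_1\Sigma_2^{-1})-\log\det(\Sigma_1\Sigma_2^{-1})-n$. Let $\mathbb{S}^n_0\subseteq\mathbb{S}^n$ be the subspace of matrices with zero diagonal; the set of correlation matrices is $(I_n+\mathbb{S}^n_0)\cap\mathbb{S}^n_+$, i.e. the positive definite matrices with all diagonal entries equal to $1$. A linear correlation model is a set $M=(I_n+\mathcal{L})\cap\mathbb{S}^n_+$ with $\mathcal{L}\subseteq\mathbb{S}^n_0$ a linear subspace. The convexity cone $C(M)$ is the set of all $S\in\mathbb{S}^n_+$ for which $\Sigma\mapsto I(S\|\Sigma)$ is a convex function on $M$. *)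

(* Defs.v *)
From HB Require Import structures.
From mathcomp Require Import all_boot all_order all_algebra.
From mathcomp Require Import all_classical all_reals all_analysis.

Set Implicit Arguments.
Unset Strict Implicit.
Unset Printing Implicit Defensive.

Import Order.TTheory GRing.Theory Num.Theory.

Local Open Scope classical_set_scope.
Local Open Scope ring_scope.

Section CorrelationModels.
Variables (R : realType) (n : nat).
Implicit Types (S Sigma A : 'M[R]_n) (M : set 'M[R]_n).

Definition posdef : set 'M[R]_n :=
  [set A | A \is symmetricmx /\
    forall v : 'cV[R]_n, v != 0 -> 0 < (v^T *m A *m v) 0 0].

Definition info_div S Sigma : R :=
  \tr (S *m invmx Sigma) - ln (\det (S *m invmx Sigma)) - n%:R.

Definition sym_zero_diag : set 'M[R]_n :=
  [set A | A \is symmetricmx /\ forall i, A i i = 0].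

Definition correlation_matrices : set 'M[R]_n :=
  [set 1%:M + A | A in sym_zero_diag] `&` posdef.

Definition linear_correlation_model M : Prop :=
  exists2 L : {vspace 'M[R]_n}, [set` L] `<=` sym_zero_diag &
    M = [set 1%:M + A | A in [set` L]] `&` posdef.

Definition convexity_cone M : set 'M[R]_n :=
  [set S | posdef S /\ convex_function (E := 'M[R]_n) M (info_div S)].

End CorrelationModels.

Arguments correlation_matrices : clear implicits.

(* Main.v *)
Require Import Defs.
From mathcomp Require Import all_boot all_order all_algebra.
From mathcomp Require Import all_classical all_reals all_analysis.
From mathcomp Require Import spectral complex ring lra.
Import Order.TTheory GRing.Theory Num.Theory.
Import numFieldNormedType.Exports.
Local Open Scope classical_set_scope.
Local Open Scope ring_scope.
Local Open Scope convex_scope.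

(** For [S = t I] the function is, up to an additive constant,
    [Sigma |-> t tr(Sigma^-1) + ln det Sigma]: a convex term plus a concave one.
    The convex term wins as long as [Sigma <= 2 t I] in the Loewner order, and
    correlation matrices satisfy [Sigma <= n I] because they are positive with
    trace [n] ([correlation_form_le] gives an entrywise argument).  Hence
    [t >= n / 2] is enough.

    To see that [Sigma <= 2 t I] is the right region, take two points [X] and
    [Y] in it.  They are diagonalized simultaneously by congruence: there is an
    invertible [P] with [P X P^* = I] and [P Y P^* = diag(d)]
    ([hermitian_pencil_diag]).  On the segment between them the determinant and
    the trace of the inverse then split into one-variable terms
    ([posdef_pencil]):

      [det(a X + b Y) = det X * prod_i (a + b d_i)],
      [tr((a X + b Y)^-1) = sum_i c_i / (a + b d_i)],

    where [c_i] is the squared norm of the [i]-th row [p_i] of [P].  So the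
    function is a constant plus a sum of [t c_i / s + ln s] with [s] running
    linearly from [1] to [d_i].  The second derivative of this term is
    [(2 t c_i - s) / s^3], so it is convex for [s <= 2 t c_i]
    ([convex_inv_plus_ln]).  Both ends of the segment are in that range, since
    [1] and [d_i] are the values at [p_i] of the forms [X] and [Y], which are
    bounded by [2 t c_i] because [X, Y <= 2 t I].

    The spectral theorem is applied over [R[i]]; the form of a real symmetric
    matrix at a complex vector is the sum of its values at the real and
    imaginary parts ([hermitian_form_real]), which brings everything back to
    real quadratic forms.

    Every linear correlation model is a subset of the correlation matrices, so
    any [t I] with [t > 0] and [t >= n / 2] is in its convexity cone. *)

(** * The one-variable function *)

(** The second derivative of [s |-> a / s + ln s] is [(2 a - s) / s^3]. *)
Lemma convex_inv_plus_ln (R : realType) (a x y : R^o) (t : {i01 R}) :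
  0 < x <= 2 * a -> 0 < y <= 2 * a ->
  (fun s : R => a * s^-1 + ln s : R^o) (x <| t |> y) <=
  (a * x^-1 + ln x : R^o) <| t |> (a * y^-1 + ln y : R^o).
Proof.
move=> hx hy; pose g (s : R) : R^o := a * s^-1 + ln s.
rewrite -[leLHS]/(g _) -[a * x^-1 + _]/(g x) -[a * y^-1 + _]/(g y).
wlog xy : x y t hx hy / x <= y.
  move=> H; have [xy|/ltW yx] := leP x y; first exact: H.
  by rewrite convC [leRHS]convC; exact: H.
move: hx hy => /andP[x0 _] /andP[y0 y2].
have dg (s : R) : 0 < s -> is_derive s 1 g (s^-1 - a * s ^- 2).
  move=> s0; have sn0 : s != 0 by rewrite gt_eqF.
  have := @is_deriveV R id s 1 1 sn0 (is_derive_id _ _) => dV.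
  have dl := is_derive1_ln s0.
  by apply: is_derive_eq; rewrite /= /GRing.scale /=; ring.
have dDg (s : R) : 0 < s -> is_derive s 1 ('D_1 g) (2 * a * s ^- 3 - s ^- 2).
  move=> s0; have sn0 : s != 0 by rewrite gt_eqF.
  apply: (@near_eq_is_derive R R^o R^o (fun z => z^-1 - a * (z^-1) ^+ 2 : R^o)).
    near=> z; have z0 : 0 < z by near: z; exact: lt_nbhsr.
    by have := dg _ z0 => ?; rewrite derive_val exprVn.
  have := @is_deriveV R id s 1 1 sn0 (is_derive_id _ _) => dV.
  by apply: is_derive_eq; rewrite /= /GRing.scale /=; field.
have gcont (s : R) : 0 < s -> {for s, continuous g}.
  move=> s0; apply: differentiable_continuous; apply/derivable1_diffP.
  by have [] := dg _ s0.
apply: second_derivative_convex => //.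
- move=> z /andP[xz zy]; have z0 := lt_trans x0 xz.
  have := dDg _ z0 => ?; rewrite derive_val.
  have -> : 2 * a * z ^- 3 - z ^- 2 = (2 * a - z) * z ^- 3.
    by field; rewrite gt_eqF.
  rewrite mulr_ge0 // ?invr_ge0 ?exprn_ge0 ?(ltW z0)//.
  by rewrite subr_ge0 (le_trans (ltW zy)).
- exact/cvg_at_left_filter/gcont.
- exact/cvg_at_right_filter/gcont.
- by move=> z; rewrite in_itv /= => /andP[xz _]; have [] := dg _ (lt_trans x0 xz).
- by move=> z; rewrite in_itv /= => /andP[xz _]; have [] := dDg _ (lt_trans x0 xz).
Unshelve. all: by end_near.
Qed.

Lemma ln_prod (R : realType) (I : finType) (F : I -> R) :
  (forall i, 0 < F i) -> ln (\prod_i F i) = \sum_i ln (F i).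
Proof.
move=> F0; suff [] : 0 < \prod_i F i /\ ln (\prod_i F i) = \sum_i ln (F i) by [].
elim/big_rec2: _ => [|i s p _ [p0 <-]]; first by rewrite ln1 ltr01.
by rewrite mulr_gt0 // lnM ?posrE.
Qed.

(** * Simultaneous diagonalization by congruence *)

(** After rescaling the orthonormal eigenvectors of [X], the form [X] becomes
    the standard one; a unitary change of basis, which preserves the standard
    form, then diagonalizes [Y]. *)
Lemma hermitian_pencil_diag (C : numClosedFieldType) (n : nat) (X Y : 'M[C]_n) :
  X \is hermsymmx -> Y \is hermsymmx ->
  (forall v : 'rV[C]_n, v != 0 -> 0 < (v *m X *m (v ^t Num.conj)%sesqui) 0 0) ->
  exists (P : 'M[C]_n) (d : 'rV[C]_n),
    P *m X *m (P ^t Num.conj)%sesqui = 1%:M /\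
    P *m Y *m (P ^t Num.conj)%sesqui = diag_mx d.
Proof.
move=> Xherm Yherm Xpos.
pose star m p (A : 'M[C]_(m, p)) := (A ^t Num.conj)%sesqui.
have starM m p q (A : 'M[C]_(m, p)) (B : 'M[C]_(p, q)) :
  star _ _ (A *m B) = star _ _ B *m star _ _ A by rewrite /star trmx_mul map_mxM.
have congr_herm (Q A : 'M[C]_n) :
    A \is hermsymmx -> Q *m A *m star _ _ Q \is hermsymmx.
  rewrite !is_hermitianmxE !expr0 !scale1r -!/(star _ _ _) => /eqP Astar.
  by apply/eqP; rewrite !starM -Astar {2}/star {2}/star trmxCK mulmxA.
have diagonalized (A : 'M[C]_n) : A \is hermsymmx ->
    exists (U : 'M[C]_n) (e : 'rV[C]_n),
    U \is unitarymx /\ U *m A *m star _ _ U = diag_mx e.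
  move=> Aherm; exists (spectralmx A), (spectral_diag A).
  split; first exact: spectral_unitarymx.
  have /hermitian_normalmx/orthomx_spectralP Aeq := Aherm.
  rewrite [in X in _ *m X *m _]Aeq /star -invmx_unitary ?spectral_unitarymx //.
  by rewrite !mulmxA mulmxV ?spectral_unit // mul1mx mulmxK ?spectral_unit.
have [U [e [Uu UX]]] := diagonalized X Xherm.
have e_gt0 i : 0 < e 0 i.
  have -> : e 0 i = (row i U *m X *m star _ _ (row i U)) 0 0.
    have := congr1 (fun B : 'M[C]_n => B i i) UX.
    rewrite /= [RHS]mxE eqxx mulr1n => <-.
    by rewrite -row_mul !mxE; apply: eq_bigr => k _; rewrite !mxE.
  apply: Xpos; apply/eqP => Ui0.
  have /unitarymxP/(congr1 (fun B : 'M[C]_n => B i i)) := Uu.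
  rewrite !mxE eqxx big1 ?mulr1n => [/eqP|k _]; first by rewrite eq_sym oner_eq0.
  by have /rowP/(_ k) := Ui0; rewrite !mxE => ->; rewrite mul0r.
pose D := diag_mx (\row_i (sqrtC (e 0 i))^-1); pose W := D *m U.
have Dstar : star _ _ D = D.
  rewrite /star tr_diag_mx map_diag_mx; congr diag_mx; apply/rowP => i; rewrite !mxE.
  by rewrite fmorphV /= geC0_conj ?sqrtC_ge0 // ltW.
have WX : W *m X *m star _ _ W = 1%:M.
  rewrite starM Dstar /W -!mulmxA [X in _ *m X]mulmxA [X in _ *m X]mulmxA UX.
  rewrite !mulmx_diag -diag_const_mx; congr diag_mx; apply/rowP => i; rewrite !mxE.
  by rewrite mulrCA -expr2 exprVn sqrtCK ?divff // gt_eqF.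
have [V [d [/unitarymxP Vu VY]]] := diagonalized _ (congr_herm W Y Yherm).
exists (V *m W), d; rewrite -/(star _ _ (V *m W)) starM.
have conj_comp A : V *m W *m A *m (star _ _ W *m star _ _ V) =
    V *m (W *m A *m star _ _ W) *m star _ _ V by rewrite !mulmxA.
by rewrite !conj_comp WX mulmx1.
Qed.

Section Pencil.
Variables (R : realType) (n : nat).
Implicit Types (A X Y : 'M[R]_n) (v : 'rV[R]_n) (p : 'rV[R[i]]_n).

Definition qform A v : R := (v *m A *m v^T) 0 0.

Local Notation toC := (map_mx (real_complex R)).
Local Notation Re := (map_mx (@complex.Re R)).
Local Notation Im := (map_mx (@complex.Im R)).

Lemma symmetricmxP A : reflect (A^T = A) (A \is symmetricmx).
Proof.
by rewrite is_hermitianmxE expr0 scale1r map_mx_id_in // eq_sym; exact: eqP.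
Qed.

Lemma posdef_qform_gt0 A v : posdef A -> v != 0 -> 0 < qform A v.
Proof.
by move=> [_ Apos] v0; rewrite /qform -[v in v *m A]trmxK Apos // trmx_eq0.
Qed.

(** The cross terms between the real and the imaginary part cancel because [A]
    is symmetric. *)
Lemma hermitian_form_real A p : A^T = A ->
  (p *m toC A *m (p ^t Num.conj)%sesqui) 0 0 =
  (qform A (Re p) + qform A (Im p))%:C%C.
Proof.
rewrite /qform => Asym; set u := map_mx _ p; set w := map_mx _ p.
have cross : (w *m A *m u^T) 0 0 = (u *m A *m w^T) 0 0.
  have -> : (w *m A *m u^T) 0 0 = (w *m A *m u^T)^T 0 0 by rewrite [RHS]mxE.
  by rewrite !trmx_mul trmxK Asym mulmxA.
have -> : p = toC u + 'i%C *: toC w.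
  by apply/rowP => k; rewrite !mxE [LHS]complexE.
have -> : ((toC u + 'i%C *: toC w) ^t Num.conj)%sesqui =
          toC u^T - 'i%C *: toC w^T.
  apply/colP => k; rewrite !mxE; apply/eqP; rewrite -[Num.conj _]/(conjc _).
  by rewrite eq_complex /=; apply/andP; split; apply/eqP; ring.
rewrite mulmxDl mulmxBr !mulmxDl -!scalemxAl -!scalemxAr -!map_mxM !mxE.
by move: cross; rewrite !mxE => ->; rewrite rmorphD /= mulrA -expr2 sqr_i; ring.
Qed.

Lemma posdef_hermitian_gt0 A p : posdef A -> p != 0 ->
  0 < qform A (Re p) + qform A (Im p).
Proof.
move=> Apos p0.
have form_ge0 v : 0 <= qform A v.
  have [->|v0] := eqVneq v 0; first by rewrite /qform !mul0mx mxE.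
  exact/ltW/posdef_qform_gt0.
have [Re0|Re0] := eqVneq (Re p) 0; last by rewrite ltr_wpDr // posdef_qform_gt0.
rewrite ltr_wpDl // posdef_qform_gt0 //; apply: contra_neq p0 => Im0.
apply/rowP => k; rewrite mxE [LHS]complexE.
move/rowP/(_ k): Re0; move/rowP/(_ k): Im0; rewrite !mxE => -> ->.
by rewrite mulr0 addr0.
Qed.

(** The matrices [u] and [w] are the real and imaginary parts of a complex
    congruence [P] that takes [X] to the identity and [Y] to a diagonal matrix;
    [Q A i] is the value of the form of [A] at the [i]-th row of [P]. *)
Lemma posdef_pencil X Y : posdef X -> posdef Y ->
  exists u w : 'M[R]_n,
  let Q A i := qform A (row i u) + qform A (row i w) in
  [/\ forall i, Q X i = 1, forall i, 0 < Q Y i, 0 < \det X &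
     forall a b : R, (forall i, a + b * Q Y i != 0) ->
     \det (a *: X + b *: Y) = \det X * \prod_i (a + b * Q Y i) /\
     \tr (invmx (a *: X + b *: Y)) = \sum_i Q 1%:M i / (a + b * Q Y i)].
Proof.
move=> Xpd Ypd.
have [/symmetricmxP Xsym _] := Xpd; have [/symmetricmxP Ysym _] := Ypd.
have herm A : A^T = A -> toC A \is hermsymmx.
  move=> Asym; rewrite is_hermitianmxE expr0 scale1r; apply/eqP.
  apply/matrixP => i j; rewrite !mxE -[Num.conj _]/(conjc _) conjc_real.
  by rewrite -[in LHS]Asym mxE.
have [|P [d [PX PY]]] := hermitian_pencil_diag _ _ _ _ (herm _ Xsym) (herm _ Ysym).
  by move=> v v0; rewrite hermitian_form_real // ltcR; exact: posdef_hermitian_gt0.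
exists (Re P), (Im P) => Q.
have QE A i : A^T = A ->
    (P *m toC A *m (P ^t Num.conj)%sesqui) i i = (Q A i)%:C%C.
  move=> Asym; rewrite /Q -!map_row -hermitian_form_real // -row_mul !mxE.
  by apply: eq_bigr => k _; rewrite !mxE.
have QX i : Q X i = 1 by apply: complexI; rewrite -QE // PX mxE eqxx.
have dE i : d 0 i = (Q Y i)%:C%C by rewrite -QE // PY mxE eqxx mulr1n.
have /mulmx1_unit[] := PX; rewrite unitmx_mul => /andP[Pu _] Psu.
have detP_gt0 : 0 < \det P * Num.conj (\det P).
  by rewrite mul_conjC_gt0 -unitfE -unitmxE.
have detC A : \det (P *m toC A *m (P ^t Num.conj)%sesqui) =
    \det P * Num.conj (\det P) * (\det A)%:C%C.
  by rewrite !det_mulmx !det_map_mx det_tr mulrAC.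
have detX : \det P * Num.conj (\det P) * (\det X)%:C%C = 1 by rewrite -detC PX det1.
split => //.
- move=> i; rewrite /Q -!map_row; apply: posdef_hermitian_gt0 => //.
  apply/eqP => Pi0; have : (row i P *m toC X *m (P ^t Num.conj)%sesqui) 0 i = 1.
    by rewrite -!row_mul PX !mxE eqxx.
  by rewrite Pi0 !mul0mx mxE => /esym/eqP; rewrite oner_eq0.
- by rewrite -ltcR -(pmulr_rgt0 _ detP_gt0) detX ltr01.
move=> a b abn0; set M := a *: X + b *: Y.
have PM : P *m toC M *m (P ^t Num.conj)%sesqui =
          diag_mx (\row_i (a + b * Q Y i)%:C%C).
  rewrite /M map_mxD !map_mxZ mulmxDr mulmxDl -!scalemxAr -!scalemxAl PX PY.
  apply/matrixP => i j; rewrite !mxE dE /=.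
  case: eqP => _; rewrite ?mulr1n ?mulr0n ?mulr1 ?mulr0 ?addr0 //.
  by move: (Q Y i) => q; rewrite rmorphD rmorphM.
split.
  have detP0 : \det P * Num.conj (\det P) != 0 by rewrite gt_eqF.
  apply: complexI; apply: (mulfI detP0).
  rewrite -detC PM det_diag rmorphM mulrA detX mul1r rmorph_prod /=.
  by apply: eq_bigr => i _; rewrite mxE.
pose E' : 'M[R[i]]_n := diag_mx (\row_i ((a + b * Q Y i)^-1)%:C%C).
have invM : toC (invmx M) = (P ^t Num.conj)%sesqui *m E' *m P.
  have PM' : P *m toC M = diag_mx (\row_i (a + b * Q Y i)%:C%C) *m
                          invmx (P ^t Num.conj)%sesqui by rewrite -PM mulmxK.
  have invK : (P ^t Num.conj)%sesqui *m E' *m P *m toC M = 1%:M.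
    rewrite -mulmxA PM' mulmxA -(mulmxA _ E') mulmx_diag.
    have -> : \row_j ((\row_i ((a + b * Q Y i)^-1)%:C%C) 0 j *
                      (\row_i (a + b * Q Y i)%:C%C) 0 j) = const_mx 1 :> 'rV[R[i]]_n.
      by apply/rowP => j; rewrite !mxE -rmorphM /= mulVf.
    by rewrite diag_const_mx mulmx1 mulmxV.
  have /mulmx1_unit[_ Mu] := invK.
  by rewrite map_invmx -[LHS]mul1mx -invK mulmxK.
apply: complexI; rewrite -trace_map_mx invM -mulmxA mxtrace_mulC -mulmxA.
rewrite rmorph_sum; apply: eq_bigr => i _ /=.
by rewrite mul_diag_mx !mxE mulrC rmorphM /= -QE ?trmx1 // map_mx1 mulmx1 !mxE.
Qed.

End Pencil.

(** * Convexity of the divergence from a scalar matrix *)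

Section Divergence.
Variables (R : realType) (n : nat).
Implicit Types (X Y : 'M[R]_n) (t : R).

Lemma info_div_scalar t X : 0 < t -> 0 < \det X ->
  info_div t%:M X = t * \tr (invmx X) + ln (\det X) - ln (t ^+ n) - n%:R.
Proof.
move=> t0 X0; rewrite /info_div mul_scalar_mx mxtraceZ detZ det_inv.
by rewrite ln_div ?posrE ?exprn_gt0 // opprB addrA.
Qed.

(** The hypotheses on [X] and [Y] say that both are at most [2 t I] in the
    Loewner order. *)
Lemma info_div_scalar_convex t X Y (l : {i01 R}) :
  0 < t -> posdef X -> posdef Y ->
  (forall v, qform R n X v <= 2 * t * qform R n 1%:M v) ->
  (forall v, qform R n Y v <= 2 * t * qform R n 1%:M v) ->
  info_div t%:M (l%:num *: X + (1 - l%:num) *: Y) <=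
  l%:num * info_div t%:M X + (1 - l%:num) * info_div t%:M Y.
Proof.
move=> t0 Xpd Ypd Xle Yle.
have [u [w]] := posdef_pencil _ _ _ _ Xpd Ypd.
set Q := fun _ _ => _ => -[QX QY detX pencil].
have Qle A i : (forall v, qform R n A v <= 2 * t * qform R n 1%:M v) ->
    Q A i <= 2 * (t * Q 1%:M i).
  by move=> Ale; rewrite mulrA /Q mulrDr lerD.
pose g i (s : R) := t * Q 1%:M i * s^-1 + ln s.
pose K := ln (\det X) - ln (t ^+ n) - n%:R.
have split_sum a b : (forall i, 0 < a + b * Q Y i) ->
    info_div t%:M (a *: X + b *: Y) = K + \sum_i g i (a + b * Q Y i).
  move=> ab0; have [|detE trE] := pencil a b; first by move=> i; rewrite gt_eqF.
  have prod0 : 0 < \prod_i (a + b * Q Y i) by exact: prodr_gt0.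
  rewrite info_div_scalar // detE ?mulr_gt0 // trE lnM ?posrE // ln_prod //.
  rewrite /g big_split /= mulr_sumr /K.
  under [X in _ = _ + (X + _)]eq_bigr do rewrite -mulrA.
  ring.
have fX : info_div t%:M X = K + \sum_i g i 1.
  have := split_sum 1 0; rewrite scale1r scale0r addr0 => ->; last first.
    by move=> i; rewrite mul0r addr0.
  by congr (_ + _); apply: eq_bigr => i _; rewrite mul0r addr0.
have fY : info_div t%:M Y = K + \sum_i g i (Q Y i).
  have := split_sum 0 1; rewrite scale1r scale0r add0r => ->; last first.
    by move=> i; rewrite mul1r add0r.
  by congr (_ + _); apply: eq_bigr => i _; rewrite mul1r add0r.
have seg i : l%:num + (1 - l%:num) * Q Y i = (1 : R^o) <| l |> (Q Y i : R^o).
  by rewrite convRE mulr1.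
rewrite split_sum => [|i]; last by rewrite seg convR_gt0.
rewrite fX fY; clearbody K.
rewrite !mulrDr addrACA -mulrDl subrKC mul1r lerD2l.
rewrite !mulr_sumr -big_split; apply: ler_sum => i _; rewrite seg.
apply: convex_inv_plus_ln; last by rewrite QY Qle.
by rewrite ltr01 -[X in X <= _](QX i) Qle.
Qed.

(** * Correlation matrices *)

(** Since the diagonal is [1], positivity at [x e_i - y e_j] reads
    [2 A_ij x y <= x ^ 2 + y ^ 2].  Summing this over all [i] and [j], with
    [x = v_i] and [y = v_j], produces the factor [n]. *)
Lemma correlation_form_le A (v : 'rV[R]_n) :
  correlation_matrices R n A -> qform R n A v <= n%:R * qform R n 1%:M v.
Proof.
move=> [[B [/symmetricmxP Bsym B0] BA] [/symmetricmxP Asym Apos]].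
have A1 i : A i i = 1 by rewrite -BA !mxE eqxx B0 addr0.
have entry_le i j (x y : R) : x * A i j * y <= (x ^+ 2 + y ^+ 2) / 2.
  pose w : 'cV[R]_n := x *: delta_mx i 0 - y *: delta_mx j 0.
  have : 0 <= (w^T *m A *m w) 0 0.
    by have [->|/Apos/ltW//] := eqVneq w 0; rewrite mulmx0 mxE.
  have -> : w^T = x *: delta_mx 0 i - y *: delta_mx 0 j.
    by rewrite linearB !linearZ /= !trmx_delta.
  rewrite mulmxBl mulmxBr !mulmxBl -!scalemxAl -!scalemxAr -!rowE -!colE !mxE.
  by rewrite !A1 -[A j i](congr1 (fun B : 'M[R]_n => B j i) Asym) mxE => ?; nra.
rewrite /qform.
have -> : (v *m A *m v^T) 0 0 = \sum_i \sum_j v 0 i * A i j * v 0 j.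
  rewrite exchange_big !mxE; apply: eq_bigr => j _; rewrite !mxE mulr_suml.
  by apply: eq_bigr => i _.
apply: (@le_trans _ _ (\sum_(i < n) \sum_(j < n) (v 0 i ^+ 2 + v 0 j ^+ 2) / 2)).
  by apply: ler_sum => i _; apply: ler_sum => j _; exact: entry_le.
rewrite mulmx1 mxE.
under [X in _ * X]eq_bigr do rewrite mxE -expr2.
set s := \sum_i v 0 i ^+ 2.
have -> : \sum_(i < n) \sum_(j < n) (v 0 i ^+ 2 + v 0 j ^+ 2) / 2 = n%:R * s.
  under eq_bigr do rewrite -mulr_suml big_split /= sumr_const card_ord.
  rewrite -mulr_suml big_split /= sumr_const card_ord sumrMnl -/s.
  by rewrite -[s *+ n]mulr_natl; field.
done.
Qed.

Lemma qform1_ge0 (v : 'rV[R]_n) : 0 <= qform R n 1%:M v.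
Proof.
by rewrite /qform mulmx1 mxE sumr_ge0 // => k _; rewrite mxE -expr2 sqr_ge0.
Qed.

Lemma posdef_scalar t : 0 < t -> posdef (t%:M : 'M[R]_n).
Proof.
move=> t0; split; first by apply/symmetricmxP; rewrite tr_scalar_mx.
move=> v v0; rewrite mul_mx_scalar -scalemxAl mxE pmulr_rgt0 //.
have [k vk0] : exists k, v k 0 != 0.
  by apply/existsP; apply: contraNT v0; rewrite negb_exists => /forallP v0;
     apply/eqP/colP => k; rewrite mxE; apply/eqP; have := v0 k; rewrite negbK.
rewrite mxE (bigD1 k) //= ltr_wpDr ?mxE -?expr2 ?exprn_even_gt0 //.
by rewrite sumr_ge0 // => j _; rewrite mxE -expr2 sqr_ge0.
Qed.

Lemma linear_correlation_sub (M : set 'M[R]_n) :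
  linear_correlation_model M -> M `<=` correlation_matrices R n.
Proof.
by move=> [L Lsub ->] X [[A LA AX] Xpd]; split=> //; exists A => //; exact: Lsub.
Qed.

End Divergence.

Theorem proposition4p4 (R : realType) (n : nat) :
  (forall (t : R) (S : 'M[R]_n), n%:R / 2 <= t -> S = t%:M ->
     convex_function (E := 'M[R]_n) (correlation_matrices R n) (info_div S)) /\
  (forall M : set 'M[R]_n,
     linear_correlation_model M -> convexity_cone M !=set0).
Proof.
have scalar_convex (t : R) (S : 'M[R]_n) : n%:R / 2 <= t -> S = t%:M ->
    convex_function (E := 'M[R]_n) (correlation_matrices R n) (info_div S).
  move=> nt -> l X Y /set_mem Xcor /set_mem Ycor.
  have [n0|n_gt0] := posnP n.
    (* [t] may vanish here, but there is only one matrix of size 0 *)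
    have -> : X = Y by apply/matrixP => i; have := ltn_ord i; rewrite {2}n0.
    by rewrite !convmm.
  have t_gt0 : 0 < t by rewrite (lt_le_trans _ nt) // divr_gt0 // ltr0n.
  have n_le : n%:R <= 2 * t by rewrite mulrC -ler_pdivrMr.
  have le2t A : correlation_matrices R n A ->
      forall v, qform R n A v <= 2 * t * qform R n 1%:M v.
    move=> Acor v; apply: le_trans (correlation_form_le _ _ _ _ Acor) _.
    by rewrite ler_wpM2r // qform1_ge0.
  have [_ Xpd] := Xcor; have [_ Ypd] := Ycor.
  exact: (info_div_scalar_convex _ _ _ _ _ _ t_gt0 Xpd Ypd (le2t _ Xcor) (le2t _ Ycor)).
split=> // M /linear_correlation_sub Msub.
(* the summand 1 keeps the scalar positive when [n = 0] *)
exists ((n%:R / 2 + 1)%:M); split.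
  by apply: posdef_scalar; rewrite ltr_wpDl // divr_ge0.
move=> l X Y /set_mem MX /set_mem MY.
by apply: (scalar_convex (n%:R / 2 + 1)); rewrite ?lerDl ?ler01 // inE; exact: Msub.
Qed.
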